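(* Let $r\ge 0$ be an integer. For all integers $m,n\ge 0$, $$\mathrm{LB}_{n+m}^{(r)}(x)=\sum_{k=0}^{m}\sum_{l=0}^{n}\binom{n}{l}L^{r}(m,k)\langle m+k\rangle_{n-l}\,x^{k}\,\mathrm{LB}_{l}^{(r)}(x).$$ In particular, letting $x=1$ yields $$\mathrm{LB}_{n+m}^{(r)}=\sum_{k=0}^{m}\sum_{l=0}^{n}\binom{n}{l}L^{r}(m,k)\langle m+k\rangle_{n-l}\,\mathrm{LB}_{l}^{(r)}.$$
   Context: Falling factorials: $(x)_0=1$, $(x)_n=x(x-1)\cdots(x-n+1)$ for $n\ge1$. Rising factorials: $\langle x\rangle_0=1$, $\langle x\rangle_n=x(x+1)\cdots(x+n-1)$ for $n\ge 1$. For an integer $r\ge0$, the $r$-Lah numbers $L^r(n,k)$ ($0\le k\le n$) are defined by the polynomial identity $\langle x+r\rangle_n=\sum_{k=0}^n L^r(n,k)(x)_k$ for $n\ge0$. The $r$-Lah-Bell polynomials are $\mathrm{LB}_n^{(r)}(x)=\sum_{k=0}^n L^r(n,k)x^k$ for $n\ge0$, and the $r$-Lah-Bell numbers are $\mathrm{LB}_n^{(r)}=\mathrm{LB}_n^{(r)}(1)=\sum_{k=0}^n L^r(n,k)$. *)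

(* Defs.v *)
From HB Require Import structures.
From mathcomp Require Import all_boot all_order all_algebra.

Set Implicit Arguments.
Unset Strict Implicit.
Unset Printing Implicit Defensive.

Import GRing.Theory.

Local Open Scope ring_scope.

Definition falling (R : comPzRingType) (x : R) (n : nat) : R :=
  \prod_(i < n) (x - i%:R).

Definition rising (R : comPzRingType) (x : R) (n : nat) : R :=
  \prod_(i < n) (x + i%:R).

(* [c] is the vector of coordinates of <X + r>_n on (X)_0, ..., (X)_n. *)
Definition is_rLah_row (r n : nat) (c : n.+1.-tuple int) : bool :=
  rising ('X + r%:R) n == \sum_(k < n.+1) tnth c k *: falling ('X : {poly int}) k.

Lemma fallingS (k : nat) (a : int) :
  ('X + a%:P) * falling ('X : {poly int}) k =
  falling 'X k.+1 + (a + k%:R) *: falling 'X k.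
Proof.
rewrite {2}/falling big_ord_recr /= -/(falling _ _) -mul_polyC.
rewrite [_ * ('X - _)]mulrC -mulrDl; congr (_ * _).
by rewrite polyCD (rmorph_nat (@polyC int)) addrACA addNr addr0.
Qed.

Lemma rLah_row_exists (r n : nat) : exists c : n.+1.-tuple int, is_rLah_row r c.
Proof.
suff [c Hc] : exists c : nat -> int,
    rising ('X + r%:R) n = \sum_(k < n.+1) c k *: falling ('X : {poly int}) k.
  exists [tuple c k | k < n.+1]; apply/eqP; rewrite Hc.
  by apply: eq_bigr => k _; rewrite tnth_mktuple.
elim: n => [|n [c Hc]].
  by exists (fun=> 1); rewrite big_ord1 scale1r /rising /falling !big_ord0.
pose a : int := r%:R + n%:R.
exists (fun k => (if k is j.+1 then c j else 0)
               + (if (k <= n)%N then (a + k%:R) * c k else 0)).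
rewrite /rising big_ord_recr /= -/(rising _ _) Hc mulrC.
have -> : 'X + r%:R + n%:R = 'X + a%:P :> {poly int}.
  by rewrite /a polyCD !(rmorph_nat (@polyC int)) addrA.
rewrite mulr_sumr.
under [LHS]eq_bigr => k _ do rewrite -scalerAr fallingS scalerDr scalerA.
rewrite big_split /=.
under [RHS]eq_bigr => k _ do rewrite scalerDl.
rewrite big_split /=; congr (_ + _).
  by rewrite [RHS]big_ord_recl /= scale0r add0r.
rewrite [RHS]big_ord_recr /= ltnn scale0r addr0.
by apply: eq_bigr => k _; rewrite -ltnS ltn_ord mulrC.
Qed.

Lemma rLah_row_unique (r n : nat) (c d : n.+1.-tuple int) :
  is_rLah_row r c -> is_rLah_row r d -> c = d.
Proof.
have size_falling k : size (falling ('X : {poly int}) k) = k.+1.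
  rewrite /falling -(big_mkord xpredT (fun i => 'X - i%:R : {poly int})).
  under eq_bigr => i _ do rewrite -(rmorph_nat (@polyC int)).
  by rewrite size_prod_XsubC size_iota subn0.
have lead_falling k : (falling ('X : {poly int}) k)`_k = 1.
  have: falling ('X : {poly int}) k \is monic.
    rewrite /falling; apply: monic_prod => i _.
    by rewrite -(rmorph_nat (@polyC int)) monicXsubC.
  by rewrite monicE lead_coefE size_falling => /eqP.
have free N (e : nat -> int) :
    \sum_(k < N) e k *: falling ('X : {poly int}) k = 0 ->
    forall k, (k < N)%N -> e k = 0.
  elim: N => [//|N IHN]; rewrite big_ord_recr /= => He.
  have eN : e N = 0.
    move/(congr1 (fun p : {poly int} => p`_N)): He.
    rewrite coefD coefZ lead_falling mulr1 coef0 coef_sum big1 ?add0r // => k _.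
    by rewrite coefZ nth_default ?mulr0 // size_falling.
  move: He; rewrite eN scale0r addr0 => He k.
  by rewrite ltnS leq_eqVlt => /predU1P[-> // | /(IHN He)].
move=> /eqP Hc /eqP Hd; apply: eq_from_tnth => i; apply/eqP.
rewrite -subr_eq0 !(tnth_nth 0); apply/eqP.
apply: (free n.+1 (fun k => c`_k - d`_k)) => //.
under eq_bigr => k _ do rewrite scalerBl -!tnth_nth.
by rewrite sumrB -Hc -Hd subrr.
Qed.

(* L^r(n, k), extended by 0 for k > n; [rLah_row_unique] makes the choice
   immaterial. *)
Definition rLah (r n k : nat) : int := (xchoose (rLah_row_exists r n))`_k.

Lemma rLahP (r n : nat) :
  rising ('X + r%:R) n = \sum_(k < n.+1) rLah r n k *: falling ('X : {poly int}) k.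
Proof.
rewrite (eqP (xchooseP (rLah_row_exists r n))).
by apply: eq_bigr => k _; rewrite (tnth_nth 0).
Qed.

Definition rLahBell_poly (r n : nat) : {poly int} :=
  \sum_(k < n.+1) rLah r n k *: 'X^k.

Definition rLahBell (r n : nat) : int := (rLahBell_poly r n).[1].

Lemma rLahBellE (r n : nat) : rLahBell r n = \sum_(k < n.+1) rLah r n k.
Proof.
rewrite /rLahBell horner_sum; apply: eq_bigr => k _.
by rewrite hornerZ hornerXn expr1n mulr1.
Qed.

(* Main.v *)
(** The Z-linear map [umbral], sending X^k to (X)_k, is injective and sends
    LB_n to <X + r>_n, so the identity may be checked after applying it.  There
    it follows from <X + r>_(n+m) = <X + r>_m <X + r + m>_n: expand the first
    factor on the (X)_k, write X + r + m = (X - k + r) + (m + k) in the second,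
    and use the binomial theorem for rising factorials together with
    (X)_(k+j) = (X)_k (X - k)_j. *)
Require Import Defs.
From HB Require Import structures.
From mathcomp Require Import all_boot all_order all_algebra.
From mathcomp Require Import ring.
Import GRing.Theory.
Local Open Scope ring_scope.

Lemma fallingD (R : comPzRingType) (x : R) (k j : nat) :
  falling x (k + j) = falling x k * falling (x - k%:R) j.
Proof.
rewrite /falling big_split_ord /=; congr (_ * _).
by apply: eq_bigr => i _; rewrite natrD opprD addrA.
Qed.

Lemma risingD (R : comPzRingType) (x : R) (m n : nat) :
  rising x (m + n) = rising x m * rising (x + m%:R) n.
Proof.
rewrite /rising big_split_ord /=; congr (_ * _).
by apply: eq_bigr => i _; rewrite natrD addrA.
Qed.

Lemma risingS (R : comPzRingType) (x : R) (n : nat) :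
  rising x n.+1 = rising x n * (x + n%:R).
Proof. by rewrite /rising big_ord_recr. Qed.

(** Induction on [n], as for the ordinary binomial theorem: the new factor is distributed over the
    two rising factorials and Pascal's rule recombines the terms. *)
Lemma rising_binomial (R : comPzRingType) (x y : R) (n : nat) :
  rising (x + y) n =
    \sum_(l < n.+1) 'C(n, l)%:R * (rising x l * rising y (n - l)).
Proof.
elim: n => [|n IHn].
  by rewrite big_ord1 bin0 mul1r /rising !big_ord0 mul1r.
rewrite risingS IHn mulr_suml.
transitivity
    (\sum_(l < n.+1) 'C(n, l)%:R * (rising x l.+1 * rising y (n - l)) +
     \sum_(l < n.+1) 'C(n, l)%:R * (rising x l * rising y (n - l).+1)).
  rewrite -big_split /=; apply: eq_bigr => l _.
  have le_ln : (l <= n)%N by rewrite -ltnS.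
  (* This split depends on [l]: the first summand is the next factor of [rising x l], the second
     that of [rising y (n - l)]. *)
  have -> : x + y + n%:R = (x + l%:R) + (y + (n - l)%:R).
    by rewrite addrACA -natrD subnKC.
  by rewrite !risingS; ring.
(* The term with [l = 0] comes only from the sum that raises [y]; the others are matched by Pascal's
   rule at [l.+1]. *)
rewrite addrC big_ord_recl [RHS]big_ord_recl /= !bin0 !subn0 -addrA.
congr (_ + _).
under [RHS]eq_bigr => l _ do rewrite /bump /= add1n binS natrD mulrDl subSS.
rewrite big_split /=; congr (_ + _).
(* The extra top term carries ['C(n, n.+1) = 0]. *)
rewrite [RHS]big_ord_recr /= bin_small // mul0r addr0.
by apply: eq_bigr => l _; rewrite /bump /= add1n -subSn ?subSS.
Qed.

Lemma falling_comp_poly (p q : {poly int}) (k : nat) :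
  falling p k \Po q = falling (p \Po q) k.
Proof.
rewrite /falling rmorph_prod; apply: eq_bigr => i _ /=.
by rewrite rmorphB /= rmorph_nat.
Qed.

Lemma rising_comp_poly (p q : {poly int}) (k : nat) :
  rising p k \Po q = rising (p \Po q) k.
Proof.
rewrite /rising rmorph_prod; apply: eq_bigr => i _ /=.
by rewrite rmorphD /= rmorph_nat.
Qed.

Lemma rising_polyC (a : int) (n : nat) : rising a%:P n = (rising a n)%:P.
Proof.
rewrite /rising rmorph_prod; apply: eq_bigr => i _ /=.
by rewrite rmorphD /= rmorph_nat.
Qed.

Lemma falling_XE (k : nat) :
  falling ('X : {poly int}) k = \prod_(i <- iota 0 k) ('X - (i%:R)%:P).
Proof.
rewrite /falling -(big_mkord xpredT (fun i => 'X - i%:R : {poly int})).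
rewrite /index_iota subn0.
by apply: eq_bigr => i _; rewrite rmorph_nat.
Qed.

Lemma size_falling_X (k : nat) : size (falling ('X : {poly int}) k) = k.+1.
Proof. by rewrite falling_XE size_prod_XsubC size_iota. Qed.

Lemma falling_X_monic (k : nat) : falling ('X : {poly int}) k \is monic.
Proof. by rewrite falling_XE monic_prod_XsubC. Qed.

Definition umbral (p : {poly int}) : {poly int} :=
  \sum_(i < size p) p`_i *: falling 'X i.

(** Coefficients beyond the size vanish. Linearity uses this to bring polynomials of different sizes
    to a common range. *)
Lemma umbralE (N : nat) (p : {poly int}) :
  (size p <= N)%N -> umbral p = \sum_(i < N) p`_i *: falling 'X i.
Proof.
move=> le_pN; rewrite /umbral.
rewrite (big_ord_widen N (fun i => p`_i *: falling ('X : {poly int}) i) le_pN).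
rewrite big_mkcond /=; apply: eq_bigr => i _.
by case: ltnP => // le_pi; rewrite nth_default // scale0r.
Qed.

Lemma umbral_is_linear : linear umbral.
Proof.
move=> a p q; pose N := maxn (size p) (size q).
have le_pN : (size p <= N)%N by rewrite leq_maxl.
have le_qN : (size q <= N)%N by rewrite leq_maxr.
have le_sN : (size (a *: p + q)%R <= N)%N.
  apply: leq_trans (size_polyD _ _) _.
  by rewrite geq_max le_qN (leq_trans (size_scale_leq _ _)).
rewrite (umbralE _ _ le_sN) (umbralE _ _ le_pN) (umbralE _ _ le_qN) scaler_sumr -big_split.
by apply: eq_bigr => i _; rewrite /= coefD coefZ scalerDl scalerA.
Qed.

HB.instance Definition _ :=
  GRing.isLinear.Build int {poly int} {poly int} _ umbral umbral_is_linear.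

Lemma umbralXn (k : nat) : umbral 'X^k = falling 'X k.
Proof.
rewrite /umbral size_polyXn big_ord_recr /= coefXn eqxx scale1r big1 ?add0r //.
by move=> i _; rewrite coefXn ltn_eqF // scale0r.
Qed.

(** Triangularity: each (X)_i is monic of degree i, so [p] and [umbral p] have the same leading
    coefficient. *)
Lemma umbral_eq0 (p : {poly int}) : umbral p = 0 -> p = 0.
Proof.
move=> Up0; apply/eqP; rewrite -lead_coef_eq0 lead_coefE.
case def_n: (size p) => [|n]; first by rewrite nth_default ?def_n.
move/(congr1 (fun q : {poly int} => q`_n)): Up0.
(* In degree [n] only the last summand contributes, the earlier ones having smaller degree. *)
rewrite /umbral def_n big_ord_recr /= coefD coefZ coef0 coef_sum big1 => [|i _].
  have /monicP := falling_X_monic n.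
  by rewrite lead_coefE size_falling_X /= => ->; rewrite mulr1 add0r => ->.
by rewrite coefZ [X in _ * X]nth_default ?mulr0 // size_falling_X.
Qed.

Lemma umbral_inj : injective umbral.
Proof.
move=> p q eq_pq; apply/eqP; rewrite -subr_eq0; apply/eqP/umbral_eq0.
by rewrite linearB /= eq_pq subrr.
Qed.

(** By linearity it suffices to treat monomials ['X^i], where this is the splitting of (X)_(k+i)
    given by [fallingD]. *)
Lemma umbral_mulXn (k : nat) (p : {poly int}) :
  umbral ('X^k * p) = falling 'X k * (umbral p \Po ('X - k%:R)).
Proof.
rewrite -[p in LHS]coefK poly_def mulr_sumr linear_sum /=.
rewrite {2}/umbral linear_sum mulr_sumr; apply: eq_bigr => i _.
rewrite -scalerAr -exprD !linearZ /= umbralXn fallingD.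
by rewrite falling_comp_poly comp_polyX scalerAr.
Qed.

Lemma umbral_rLahBell_poly (r n : nat) :
  umbral (rLahBell_poly r n) = rising ('X + r%:R) n.
Proof.
rewrite rLahP /rLahBell_poly linear_sum; apply: eq_bigr => k _.
by rewrite linearZ /= umbralXn.
Qed.

Lemma rLahBell_poly_add (r m n : nat) :
  rLahBell_poly r (n + m) =
    \sum_(k < m.+1) \sum_(l < n.+1)
      ('C(n, l)%:R * rLah r m k * rising (m + k)%:R (n - l))
        *: ('X^k * rLahBell_poly r l).
Proof.
apply: umbral_inj; rewrite umbral_rLahBell_poly addnC risingD rLahP mulr_suml.
rewrite linear_sum; apply: eq_bigr => k _ /=; rewrite linear_sum /=.
have -> : 'X + r%:R + m%:R = ('X - k%:R + r%:R) + (m + k)%:R :> {poly int}.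
  by rewrite natrD; ring.
rewrite rising_binomial mulr_sumr; apply: eq_bigr => l _.
(* Substituting X - k into <X + r>_l produces exactly the first rising factorial of the binomial
   expansion. *)
rewrite linearZ /= umbral_mulXn umbral_rLahBell_poly rising_comp_poly.
rewrite comp_polyD comp_polyX (rmorph_nat (comp_poly _)).
(* The other rising factorial has a constant argument, so it is an integer scalar. *)
rewrite -(rmorph_nat (@polyC int) (m + k)) rising_polyC.
rewrite -!mul_polyC !polyCM (rmorph_nat (@polyC int)).
by ring.
Qed.

Theorem theorem2p6 (r m n : nat) :
  rLahBell_poly r (n + m) =
    \sum_(k < m.+1) \sum_(l < n.+1)
      ('C(n, l)%:R * rLah r m k * rising (m + k)%:R (n - l))
        *: ('X^k * rLahBell_poly r l)
  /\
  rLahBell r (n + m) =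
    \sum_(k < m.+1) \sum_(l < n.+1)
      'C(n, l)%:R * rLah r m k * rising (m + k)%:R (n - l) * rLahBell r l.
Proof.
split; first exact: rLahBell_poly_add.
rewrite {1}/rLahBell rLahBell_poly_add horner_sum; apply: eq_bigr => k _.
rewrite horner_sum; apply: eq_bigr => l _.
by rewrite hornerZ hornerM hornerXn expr1n mul1r.
Qed.
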